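(* Let $n\ge1$ be an integer, $\alpha\in(0,1]$, $\beta>0$, let $I\subseteq(0,\infty)$ be an open interval, and let $p_0,\dots,p_{n-1},f:I\to\mathbb{R}$. Let $y_1,\dots,y_n$ be functions on $I$ such that, for arbitrary constants $c_1,\dots,c_n$, $u(t)=\sum_{i=1}^{n}c_iy_i(t)$ is a solution of the homogeneous equation $${}^{n}D^{\alpha,\beta}_{M}y+p_{n-1}(t)\,{}^{n-1}D^{\alpha,\beta}_{M}y+\dots+p_{1}(t)\,D^{\alpha,\beta}_{M}y+p_{0}(t)\,y=0 .$$ Then $$v(t)=\sum_{i=1}^{n}c_i(t)y_i(t)$$ is a particular solution on $I$ of the equation $${}^{n}D^{\alpha,\beta}_{M}y+p_{n-1}(t)\,{}^{n-1}D^{\alpha,\beta}_{M}y+\dots+p_{1}(t)\,D^{\alpha,\beta}_{M}y+p_{0}(t)\,y=f(t),$$ whenever $c_1(t),\dots,c_n(t)$ are $M$-differentiable functions on $I$ satisfying the system $$\sum_{i=1}^{n}D^{\alpha,\beta}_{M}c_i(t)\;{}^{k}D^{\alpha,\beta}_{M}y_i(t)=0\quad(k=0,1,\dots,n-2),\qquad \sum_{i=1}^{n}D^{\alpha,\beta}_{M}c_i(t)\;{}^{n-1}D^{\alpha,\beta}_{M}y_i(t)=f(t)$$ for all $t\in I$.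
   Context: For $\beta>0$, $\mathbb{E}_\beta(z)=\sum_{k=0}^{\infty}\frac{z^k}{\Gamma(\beta k+1)}$ is the one-parameter Mittag-Leffler function. For $0<\alpha\le 1$, $\beta>0$, the $M$-fractional derivative of order $\alpha$ of a function $f$ at a point $t>0$ is $$D^{\alpha,\beta}_{M}f(t)=\lim_{\epsilon\to0}\frac{f\big(t\,\mathbb{E}_\beta(\epsilon t^{-\alpha})\big)-f(t)}{\epsilon},$$ and $f$ is $M$-differentiable at $t$ if this limit exists. ${}^{k}D^{\alpha,\beta}_{M}$ denotes $D^{\alpha,\beta}_{M}$ iterated $k$ times, with ${}^{0}D^{\alpha,\beta}_{M}y=y$. A solution on $I$ is an $n$ times $M$-differentiable function on $I$ satisfying the equation at every point of $I$. *)

(* Defs.v *)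
From mathcomp Require Import all_boot all_order all_algebra.
From mathcomp Require Import all_classical all_reals all_analysis.
Set Implicit Arguments.
Unset Strict Implicit.
Unset Printing Implicit Defensive.
Import Order.TTheory GRing.Theory Num.Theory.
Import numFieldNormedType.Exports.
Local Open Scope classical_set_scope.
Local Open Scope ring_scope.

(* Euler's integral; only meaningful for x > 0. *)
Definition Gamma (R : realType) (x : R) : R :=
  Rintegral (@lebesgue_measure R) `]0, +oo[
    (fun s : R => s `^ (x - 1) * expR (- s)).

Definition mittag_leffler (R : realType) (beta z : R) : R :=
  limn (series (fun k : nat => z ^+ k / Gamma (beta * k%:R + 1))).

Definition Mquot (R : realType) (alpha beta : R) (f : R -> R) (t eps : R) : R :=
  (f (t * mittag_leffler beta (eps * t `^ (- alpha))) - f t) / eps.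

(* Functions on an open interval I are represented by total functions: at a
   point t of I the limits below only involve values of f near t. *)
Definition Mdifferentiable (R : realType) (alpha beta : R) (f : R -> R)
    (t : R) : Prop :=
  cvg (Mquot alpha beta f t eps @[eps --> 0^']).

(* Junk value when f is not M-differentiable at t. *)
Definition Mderiv (R : realType) (alpha beta : R) (f : R -> R) : R -> R :=
  fun t => lim (Mquot alpha beta f t eps @[eps --> 0^']).

Definition Mderivn (R : realType) (alpha beta : R) (k : nat) (f : R -> R) :
    R -> R :=
  iter k (Mderiv alpha beta) f.

Definition Mdifferentiablen_on (R : realType) (alpha beta : R) (n : nat)
    (I : set R) (f : R -> R) : Prop :=
  forall k : nat, (k < n)%N ->
    forall t, I t -> Mdifferentiable alpha beta (Mderivn alpha beta k f) t.

Definition Msolution_on (R : realType) (alpha beta : R) (n : nat) (I : set R)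
    (p : 'I_n -> R -> R) (f y : R -> R) : Prop :=
  Mdifferentiablen_on alpha beta n I y /\
  forall t, I t ->
    Mderivn alpha beta n y t
      + \sum_(k < n) p k t * Mderivn alpha beta k y t = f t.

(* Main.v *)
Require Import Defs.
From mathcomp Require Import all_boot all_order all_algebra.
From mathcomp Require Import all_classical all_reals all_analysis.
From mathcomp Require Import measurable_realfun.
Import Order.TTheory GRing.Theory Num.Theory.
Import numFieldNormedType.Exports.
Local Open Scope classical_set_scope.
Local Open Scope ring_scope.

(** The operator [Mderiv] obeys the sum rule and the Leibniz rule, and this is
    all that the classical method of variation of constants uses.

    Write f* for f evaluated at the displaced point t * E(eps * t^-alpha).  The
    identity f* g* - f g = (f* - f) g* + f (g* - g) gives Leibniz' rule as soon
    as g* tends to g(t), and that holds since g* - g = eps * Mquot g is eps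
    times a convergent quotient ([is_Mderiv_shift]).  Thus Leibniz' rule is
    independent of the Mittag-Leffler function.

    Iterating the derivative is where that function matters: the next
    derivative of v at t reads the values of the previous one at displaced
    points, where a closed formula for it is available only inside I.  So the
    displaced point must tend to t ([cvg_Mshift]), that is, E must tend to 1 at
    0.  The coefficients 1 / Gamma(beta k + 1) are bounded by expR 2, so E is
    dominated by a geometric series near 0 and is continuous there, with value
    1 / Gamma(1) = 1 ([mittag_leffler_cvg0]).

    The first n - 1 equations of the system cancel the terms containing the
    derivatives of the c_i, hence for k < n the k-th derivative of v on I is
    the combination, with coefficients c_i(t), of the k-th derivatives of the
    y_i ([Mderivn_variation]).  The last equation makes f appear in the n-th
    derivative, and everything else adds up to c_i(t) times the homogeneous
    equation for y_i. *)

(** * The Mittag-Leffler function near 0 *)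

Lemma Gamma_integrand_measurable (R : realType) (x : R) (D : set R) :
  measurable_fun D (EFin \o (fun s : R => s `^ (x - 1) * expR (- s))).
Proof.
apply/measurable_EFinP; apply: measurable_funTS; apply: measurable_funM.
- exact: measurable_powR.
- by apply: measurableT_comp => //; exact: measurable_funN.
Qed.

Lemma Gamma1 (R : realType) : Gamma (1 : R) = 1.
Proof.
rewrite /Gamma /Rintegral.
suff -> : (\int[lebesgue_measure]_(s in `]0%R, +oo[)
    (s `^ (1 - 1) * expR (- s))%:E = 1 :> \bar R)%E by [].
(* The integrand is the density of the exponential law of rate 1, except that
   the latter also charges the null set {0}. *)
rewrite -(@integral_exponential_pdf R 1 ltr01) /exponential_pdf.
rewrite integral_itv_obnd_cbnd; last exact: Gamma_integrand_measurable.
rewrite integral_mkcond; apply: eq_integral => s _; rewrite !patchE.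
by case: ifP => // _; rewrite subrr powRr0 !mul1r mulN1r.
Qed.

(** A finite integral is at least its part over [1, 2], where the integrand is
    at least expR (-2); an infinite one has real value 0, with inverse 0. *)
Lemma Gamma_inv_bound (R : realType) (x : R) : 1 <= x ->
  `|(Gamma x)^-1| <= expR 2.
Proof.
move=> x1; rewrite /Gamma /Rintegral.
set J := integral _ _ _.
have mJ := @Gamma_integrand_measurable R x.
have J_ge : ((expR (- 2))%:E <= J)%E.
  have <- : (\int[lebesgue_measure]_(s in `[1%R, 2%R])
      (cst (expR (- 2))%:E) s = (expR (- 2))%:E :> \bar R)%E.
    rewrite integral_cst//= lebesgue_measure_itv/= lte_fin ltr1n.
    by rewrite -EFinB -EFinM -[2 - 1]/(1 + 1 - 1) addrK mulr1.
  apply: (@le_trans _ _ (\int[lebesgue_measure]_(s in `[1%R, 2%R])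
      (s `^ (x - 1) * expR (- s))%:E)%E).
    apply: ge0_le_integral => //=.
    - exact: mJ.
    - move=> s; rewrite in_itv/= => /andP[s1 s2]; rewrite lee_fin.
      rewrite -[leLHS]mul1r ler_pM ?expR_ge0 ?ler_expR ?lerN2//.
      by rewrite -[leLHS](powRr0 s) ler_powR ?subr_ge0.
  apply: ge0_subset_integral => //=.
  - exact: mJ.
  - by move=> s _; rewrite lee_fin mulr_ge0 ?powR_ge0 ?expR_ge0.
  - move=> s /=; rewrite !in_itv/= => /andP[s1 _]; rewrite andbT.
    exact: lt_le_trans s1.
case: J J_ge => [r| |] //=; last by rewrite invr0 normr0 expR_ge0.
rewrite lee_fin => r_ge.
have r0 : 0 < r by exact: lt_le_trans (expR_gt0 _) r_ge.
rewrite ger0_norm ?invr_ge0 ?(ltW r0)// -[expR 2]invrK -expRN.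
by rewrite lef_pV2 ?posrE ?expR_gt0.
Qed.

(** For |z| < 1 the sum differs from its constant term by at most
    C / (1 - |z|) - C, the tail of the dominating geometric series. *)
Lemma bounded_pseries_cvg0 (R : realType) (C : R) (a : R ^nat) :
  (forall k, `|a k| <= C) ->
  limn (series (fun k => z ^+ k * a k)) @[z --> (0 : R)] --> a 0%N.
Proof.
move=> aC; apply/cvgrPdist_le => e e0.
have C0 : 0 <= C by exact: le_trans (normr_ge0 _) (aC 0%N).
have bnd_cvg : C / (1 - `|z|) - C @[z --> (0 : R)] --> 0.
  rewrite -[X in _ --> X](_ : C / (1 - `|0 : R|) - C = 0); last first.
    by rewrite normr0 subr0 divr1 subrr.
  apply: cvgB; last exact: cvg_cst.
  apply: cvgM; first exact: cvg_cst.
  apply: cvgV; first by rewrite normr0 subr0 oner_eq0.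
  by apply: cvgB; [exact: cvg_cst | apply: cvg_norm; exact: cvg_id].
near=> z.
have z1 : `|z| < 1.
  by near: z; apply: cvgr0_norm_lt => //; exact: cvg_id.
apply: (@le_trans _ _ (C / (1 - `|z|) - C)); last first.
  apply: le_trans (ler_norm _) _; near: z.
  exact: cvgr0_norm_le bnd_cvg _ e0.
have term_le k : `|z ^+ k * a k| <= geometric C `|z| k.
  by rewrite normrM normrX mulrC ler_wpM2r ?exprn_ge0.
have gz1 : `| `|z| | < 1 by rewrite normr_id.
have geo := @cvg_geometric_series R C `|z| gz1.
have cvS : cvgn (series (fun k => z ^+ k * a k)).
  apply: normed_cvg; apply: (@series_le_cvg _ _ (geometric C `|z|)) => //.
  - by move=> k; exact: normr_ge0.
  - by move=> k; rewrite mulr_ge0 ?exprn_ge0.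
  - exact: cvgP geo.
have dist_cvg : `|a 0%N - series (fun k => z ^+ k * a k) m| @[m --> \oo]
    --> `|a 0%N - limn (series (fun k => z ^+ k * a k))|.
  by apply: cvg_norm; apply: cvgB; [exact: cvg_cst | exact: cvS].
have tail_cvg : series (geometric C `|z|) m - C @[m --> \oo]
    --> C / (1 - `|z|) - C.
  by apply: cvgB; [exact: geo | exact: cvg_cst].
apply: ler_cvg_to dist_cvg tail_cvg _.
near=> m.
have m0 : (0 < m)%N by near: m; exists 1%N.
rewrite -(prednK m0) /series/= !big_nat_recl//= !expr0 mul1r mulr1.
rewrite opprD addNKr normrN addrC addKr.
by apply: le_trans (ler_norm_sum _ _ _) _; apply: ler_sum => k _.
Unshelve. all: by end_near.
Qed.

Lemma mittag_leffler_cvg0 (R : realType) (beta : R) : 0 < beta ->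
  mittag_leffler beta z @[z --> (0 : R)] --> (1 : R).
Proof.
move=> b0; rewrite -[X in _ --> X]invr1 -[X in X^-1](Gamma1 R).
have := @bounded_pseries_cvg0 R (expR 2)
  (fun k => (Gamma (beta * k%:R + 1))^-1).
rewrite mulr0 add0r; apply => k.
by apply: Gamma_inv_bound; rewrite lerDr mulr_ge0 // ltW.
Qed.

Lemma cvg_Mshift (R : realType) (alpha beta t : R) : 0 < beta ->
  t * mittag_leffler beta (eps * t `^ (- alpha)) @[eps --> 0^'] --> t.
Proof.
move=> b0; rewrite -[in nbhs t](mulr1 t).
apply: cvgM; first exact: cvg_cst.
apply: cvg_comp (mittag_leffler_cvg0 _ _ b0).
rewrite -[in nbhs 0](mul0r (t `^ (- alpha))).
by apply: cvgM; [exact: nbhs_dnbhs | exact: cvg_cst].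
Qed.

(** * Calculus of the M-derivative *)

Definition is_Mderiv {R : realType} (alpha beta : R) (f : R -> R) (t l : R) :=
  Mquot alpha beta f t eps @[eps --> 0^'] --> l.

Section Calculus.
Set Implicit Arguments.
Unset Strict Implicit.
Variables (R : realType) (alpha beta : R).
Implicit Types (f g : R -> R) (t l m : R) (I : set R).

Lemma MdifferentiableP f t : Mdifferentiable alpha beta f t ->
  is_Mderiv alpha beta f t (Mderiv alpha beta f t).
Proof. by []. Qed.

Lemma is_Mderiv_differentiable f t l : is_Mderiv alpha beta f t l ->
  Mdifferentiable alpha beta f t.
Proof. by move=> /cvgP. Qed.

Lemma is_Mderiv_val f t l : is_Mderiv alpha beta f t l ->
  Mderiv alpha beta f t = l.
Proof. exact: cvg_lim. Qed.

Lemma is_Mderiv_shift f t l : is_Mderiv alpha beta f t l ->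
  f (t * mittag_leffler beta (eps * t `^ (- alpha))) @[eps --> 0^'] --> f t.
Proof.
move=> fl.
have : f t + eps * Mquot alpha beta f t eps @[eps --> 0^'] --> f t + 0 * l.
  apply: cvgD; first exact: cvg_cst.
  by apply: cvgM; [exact: nbhs_dnbhs | exact: fl].
rewrite mul0r addr0; apply: cvg_trans; apply: near_eq_cvg.
near=> eps.
have eps0 : eps != 0 by near: eps; exact: nbhs_dnbhs_neq.
by rewrite /Mquot mulrC divfK// addrC subrK.
Unshelve. all: by end_near.
Qed.

Lemma is_MderivM f g t l m :
  is_Mderiv alpha beta f t l -> is_Mderiv alpha beta g t m ->
  is_Mderiv alpha beta (fun s => f s * g s) t (l * g t + f t * m).
Proof.
move=> fl gm; rewrite /is_Mderiv.
have -> : Mquot alpha beta (fun s => f s * g s) t = (fun eps =>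
    Mquot alpha beta f t eps
      * g (t * mittag_leffler beta (eps * t `^ (- alpha)))
    + f t * Mquot alpha beta g t eps).
  apply/funext => eps; rewrite /Mquot mulrAC [in RHS]mulrA -[RHS]mulrDl.
  by congr (_ / _); rewrite mulrBl mulrBr addrA subrK.
apply: cvgD; apply: cvgM => //; last exact: cvg_cst.
exact: is_Mderiv_shift gm.
Qed.

Lemma is_Mderiv_sum (n : nat) (F : 'I_n -> R -> R) (L : 'I_n -> R) t :
  (forall i, is_Mderiv alpha beta (F i) t (L i)) ->
  is_Mderiv alpha beta (fun s => \sum_(i < n) F i s) t (\sum_(i < n) L i).
Proof.
move=> FL; rewrite /is_Mderiv.
have -> : Mquot alpha beta (fun s => \sum_(i < n) F i s) t = (fun eps =>
    \sum_(i < n) Mquot alpha beta (F i) t eps).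
  by apply/funext => eps; rewrite /Mquot -sumrB mulr_suml.
by apply: cvg_big => [|i _]; [exact: add_continuous | exact: FL].
Qed.

(** The displaced point stays in the open set I for small eps, so that the
    M-derivative is a local operator. *)
Lemma is_Mderiv_local f g I t l : 0 < beta -> open I -> I t ->
  (forall s, I s -> f s = g s) ->
  is_Mderiv alpha beta g t l -> is_Mderiv alpha beta f t l.
Proof.
move=> b0 oI It fg; apply: cvg_trans; apply: near_eq_cvg.
have Inear : \forall eps \near 0^',
    I (t * mittag_leffler beta (eps * t `^ (- alpha))).
  exact: cvg_Mshift b0 _ (open_nbhs_nbhs (conj oI It)).
by apply: filterS Inear => eps Ieps; rewrite /Mquot !fg.
Qed.

End Calculus.

(** * Variation of constants *)

(** This serves twice: as the induction step for k < n - 1, where the first sum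
    vanishes, and for the last derivative, where the first sum is f. *)
Lemma is_Mderiv_variation (R : realType) (alpha beta : R) (n k : nat)
    (c y : 'I_n -> R -> R) (t : R) :
  (forall i, Mdifferentiable alpha beta (c i) t) ->
  (forall i, Mdifferentiable alpha beta (Mderivn alpha beta k (y i)) t) ->
  is_Mderiv alpha beta
    (fun s => \sum_(i < n) c i s * Mderivn alpha beta k (y i) s) t
    (\sum_(i < n) Mderiv alpha beta (c i) t * Mderivn alpha beta k (y i) t
     + \sum_(i < n) c i t * Mderivn alpha beta k.+1 (y i) t).
Proof.
move=> dc dy; rewrite -big_split /=; apply: is_Mderiv_sum => i.
by apply: is_MderivM; exact: MdifferentiableP.
Qed.

Lemma Mderivn_variation (R : realType) (alpha beta : R) (n : nat) (I : set R)
    (c y : 'I_n -> R -> R) : 0 < beta -> open I ->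
  (forall i t, I t -> Mdifferentiable alpha beta (c i) t) ->
  (forall i, Mdifferentiablen_on alpha beta n I (y i)) ->
  (forall k, (k < n.-1)%N -> forall t, I t ->
     \sum_(i < n) Mderiv alpha beta (c i) t * Mderivn alpha beta k (y i) t
     = 0) ->
  forall k, (k < n)%N -> forall t, I t ->
    Mderivn alpha beta k (fun s => \sum_(i < n) c i s * y i s) t
    = \sum_(i < n) c i t * Mderivn alpha beta k (y i) t.
Proof.
move=> b0 oI dc dy sys0; elim=> [//|k IHk] kn t It.
have kn' : (k < n)%N by exact: ltnW.
rewrite [LHS](_ : _ = Mderiv alpha beta (Mderivn alpha beta k
  (fun s => \sum_(i < n) c i s * y i s)) t) //.
have := @is_Mderiv_variation R alpha beta n k c y t (fun i => dc i t It)
  (fun i => dy i k kn' t It).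
rewrite sys0 ?add0r //; last by rewrite -ltnS prednK // (leq_ltn_trans _ kn).
by move=> /(is_Mderiv_local b0 oI It (IHk kn')) /is_Mderiv_val.
Qed.

Theorem theorem5p1 (R : realType) (n : nat) (hn : (1 <= n)%N)
  (alpha beta : R) (halpha0 : 0 < alpha) (halpha1 : alpha <= 1)
  (hbeta : 0 < beta)
  (I : set R) (hIopen : open I) (hIitv : is_interval I)
  (hIpos : I `<=` [set t : R | 0 < t])
  (p : 'I_n -> R -> R) (f : R -> R) (y : 'I_n -> R -> R)
  (hy : forall c : 'I_n -> R,
     Msolution_on alpha beta I p (fun _ => 0)
       (fun t => \sum_(i < n) c i * y i t))
  (c : 'I_n -> R -> R)
  (hc : forall (i : 'I_n) (t : R), I t -> Mdifferentiable alpha beta (c i) t)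
  (hsys0 : forall (k : nat), (k < n.-1)%N -> forall t : R, I t ->
     \sum_(i < n) Mderiv alpha beta (c i) t * Mderivn alpha beta k (y i) t = 0)
  (hsys1 : forall t : R, I t ->
     \sum_(i < n) Mderiv alpha beta (c i) t
       * Mderivn alpha beta n.-1 (y i) t = f t) :
  Msolution_on alpha beta I p f (fun t => \sum_(i < n) c i t * y i t).
Proof.
(* The constants are taken to be the j-th unit vector. *)
have ysol j : Msolution_on alpha beta I p (fun _ => 0) (y j).
  rewrite [y j](_ : _ = fun t => \sum_(i < n) (i == j)%:R * y i t) //.
  apply/funext => t; rewrite (bigD1 j) //= eqxx mul1r big1 ?addr0 // => i.
  by move=> /negPf ->; rewrite mul0r.
have dy i : Mdifferentiablen_on alpha beta n I (y i) by have [] := ysol i.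
set v := fun t => _.
have vE := @Mderivn_variation R alpha beta n I c y hbeta hIopen hc dy hsys0.
have dv k (kn : (k < n)%N) t (It : I t) :=
  @is_Mderiv_local R alpha beta _ _ I t _ hbeta hIopen It (vE k kn)
    (@is_Mderiv_variation R alpha beta n k c y t (fun i => hc i t It)
      (fun i => dy i k kn t It)).
split; first by move=> k kn t It; exact: is_Mderiv_differentiable (dv k kn t It).
move=> t It.
have n1 : (n.-1 < n)%N by rewrite prednK.
have -> : Mderivn alpha beta n v t
    = f t + \sum_(i < n) c i t * Mderivn alpha beta n (y i) t.
  have := is_Mderiv_val (dv n.-1 n1 t It).
  by rewrite hsys1 // -[Mderiv _ _ _]/(Mderivn alpha beta n.-1.+1 v) prednK.
under [X in _ + X]eq_bigr => k _ do
  rewrite [Mderivn _ _ _ v t](vE k (ltn_ord k) t It) mulr_sumr.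
rewrite exchange_big /= -addrA -big_split /= big1 ?addr0 // => i _.
under eq_bigr => k _ do rewrite mulrCA.
by rewrite -mulr_sumr -mulrDr (proj2 (ysol i) t It) mulr0.
Qed.
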